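(* Let $\mathcal{C}$ be a linear $(n,k,d,r,\delta)$-LRC over the finite field $\mathbb{F}_q$ (that is, an $[n,k,d]$ linear code over $\mathbb{F}_q$ with all-symbol locality $(r,\delta)$, where $r,\delta$ are positive integers), and let $\kappa_B\le r$ be an integer which is an upper bound on the dimension of linear codes over $\mathbb{F}_q$ of length $r+\delta-1$ and minimum distance at least $\delta$. Put $b=k-1 - \left( \left\lceil \frac{k}{\kappa_B} \right\rceil -1 \right) \kappa_B$. Then the upper bound $d \leq n - \left\lceil \frac{k}{\kappa_B} \right\rceil \mathcal{G}(\kappa_B, \delta) + \mathcal{G}(\kappa_B - b, \delta)$ is at least as strong as the upper bound $d \leq n-k +1 - \left( \left\lceil \frac{k}{r} \right\rceil -1 \right) (\delta-1)$, i.e. $$n - \left\lceil \frac{k}{\kappa_B} \right\rceil \mathcal{G}(\kappa_B, \delta) + \mathcal{G}(\kappa_B - b, \delta)\;\le\; n-k +1 - \left( \left\lceil \frac{k}{r} \right\rceil -1 \right) (\delta-1).$$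
   Context: $[n]=\{1,\dots,n\}$. An $[n,k,d]$ linear code over $\mathbb{F}_q$ has length $n$, dimension $k\ge 1$ and minimum (Hamming) distance $d$. For $I\subseteq[n]$, $\mathcal{C}|_I=\{\mathbf{c}_I:\mathbf{c}\in\mathcal{C}\}$. Locality: an $[n,k,d]$ linear code $\mathcal{C}$ has all-symbol locality $(r,\delta)$ if for every $i\in[n]$ there is a set $R\subseteq[n]$ (a repair set) with (1) $i\in R$, (2) $|R|\le r+\delta-1$, (3) the minimum distance of $\mathcal{C}|_R$ is at least $\delta$. Griesmer function over $\mathbb{F}_q$: $\mathcal{G}(k,d)=\sum_{i=0}^{k-1}\lceil d/q^i\rceil$. *)

(* Defs.v *)
From mathcomp Require Import all_boot all_order all_algebra.

Set Implicit Arguments.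
Unset Strict Implicit.
Unset Printing Implicit Defensive.

Import Order.TTheory GRing.Theory Num.Theory.
Local Open Scope ring_scope.

Definition hamming_dist (F : finFieldType) (n : nat) (x y : 'rV[F]_n) : nat :=
  #|[set i | x 0 i != y 0 i]|.

(* Holds vacuously when A has at most one element: the minimum distance of    *)
(* the zero code counts as infinite.                                          *)
Definition min_dist_at_least (F : finFieldType) (n : nat)
    (A : {pred 'rV[F]_n}) (d : nat) : Prop :=
  forall x y, x \in A -> y \in A -> x != y -> (d <= hamming_dist x y)%N.

Definition is_min_dist (F : finFieldType) (n : nat)
    (A : {pred 'rV[F]_n}) (d : nat) : Prop :=
  min_dist_at_least A d /\
  exists x y, [/\ x \in A, y \in A, x != y & hamming_dist x y = d].

Definition linear_code (F : finFieldType) (n k d : nat)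
    (C : {vspace 'rV[F]_n}) : Prop :=
  [/\ (1 <= k)%N, \dim C = k & is_min_dist C d].

(* C|_R, as a set of words of length #|R|: coordinate j of the restricted     *)
(* word is the coordinate of the original word at the j-th element of R.      *)
Definition code_restrict (F : finFieldType) (n : nat)
    (C : {vspace 'rV[F]_n}) (R : {set 'I_n}) : {set 'rV[F]_#|R|} :=
  [set colsub (@enum_val _ (mem R)) c | c in C].

Definition all_symbol_locality (F : finFieldType) (n : nat)
    (C : {vspace 'rV[F]_n}) (r delta : nat) : Prop :=
  forall i : 'I_n, exists R : {set 'I_n},
    [/\ i \in R, (#|R| <= r + delta - 1)%N
      & min_dist_at_least (code_restrict C R) delta].

Definition is_LRC (F : finFieldType) (n k d r delta : nat)
    (C : {vspace 'rV[F]_n}) : Prop :=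
  [/\ linear_code k d C, (0 < r)%N, (0 < delta)%N
    & all_symbol_locality C r delta].

(* The number of terms k is an integer so that it can be a difference of      *)
(* integers; the sum is empty when k is negative.                             *)
Definition griesmer (q : nat) (k : int) (d : nat) : int :=
  if k is Posz m then \sum_(i < m) Num.ceil (d%:R / q%:R ^+ i : rat) else 0.

Definition dim_upper_bound (F : finFieldType) (m delta : nat) (K : int) : Prop :=
  forall (k d : nat) (C : {vspace 'rV[F]_m}),
    linear_code k d C -> (delta <= d)%N -> k%:Z <= K.

(* Main.v *)
Require Import Defs.
From mathcomp Require Import all_boot all_order all_algebra.
From mathcomp Require Import zify.

(* Write kappa for kappa_B and t for ceil (k / kappa). Every term of the       *)
(* Griesmer sum is at least 1 and the first one is delta, hence                *)
(*   G kappa - G (kappa - b) >= b   and   G kappa >= delta + kappa - 1.        *)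
(* Adding the first inequality to (t - 1) times the second one bounds          *)
(* t G kappa - G (kappa - b) below by (t - 1)(delta - 1) + k - 1, and          *)
(* t >= ceil (k / r) since kappa <= r. That kappa is positive follows from     *)
(* the repetition code of length r + delta - 1.                                *)

Import Order.TTheory GRing.Theory Num.Theory.
Local Open Scope ring_scope.

Lemma one_le_griesmer_term (q d i : nat) :
  (0 < q)%N -> (0 < d)%N -> 1 <= Num.ceil (d%:R / q%:R ^+ i : rat).
Proof.
move=> q0 d0; have h : 0 < Num.ceil (d%:R / q%:R ^+ i : rat).
  by rewrite ceil_gt0 divr_gt0 ?exprn_gt0 ?ltr0n.
by lia.
Qed.

Lemma griesmerS (q m d : nat) :
  griesmer q m.+1 d = griesmer q m d + Num.ceil (d%:R / q%:R ^+ m : rat).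
Proof. by rewrite /griesmer big_ord_recr. Qed.

Lemma griesmer_diff_ge (q m p d : nat) :
  (0 < q)%N -> (0 < d)%N -> (p <= m)%N ->
  (m - p)%N%:Z <= griesmer q m d - griesmer q p d.
Proof.
move=> q0 d0 /subnKC <-; rewrite addKn.
elim: (m - p)%N => [|l IH]; first by rewrite addn0 subrr.
rewrite addnS griesmerS.
by have := one_le_griesmer_term q d (p + l) q0 d0; lia.
Qed.

Lemma griesmer_ge (q m d : nat) :
  (0 < q)%N -> (0 < d)%N -> (0 < m)%N ->
  d%:Z + m%:Z - 1 <= griesmer q m d.
Proof.
move=> q0 d0 m0; have := griesmer_diff_ge q m 1 d q0 d0 m0.
have -> : griesmer q 1 d = d.
  by rewrite griesmerS /griesmer big_ord0 add0r expr0 divr1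
             -[d%:R]/(d%:Z%:~R) intrKceil.
by lia.
Qed.

(** Distinct multiples of the all-ones word differ in every coordinate. *)
Lemma repetition_code (F : finFieldType) (m : nat) :
  (0 < m)%N -> linear_code 1 m <[const_mx 1 : 'rV[F]_m]>%VS.
Proof.
move=> m0; set u := const_mx 1.
have u0 : u != 0.
  by apply/eqP => /rowP/(_ (Ordinal m0))/eqP; rewrite !mxE oner_eq0.
have dist a b : a != b -> hamming_dist (a *: u) (b *: u) = m.
  move=> ab; rewrite /hamming_dist -[RHS]card_ord.
  by apply: eq_card => i; rewrite !inE !mxE !mulr1.
split=> //; first by rewrite dim_vline u0.
split.
  move=> x y /vlineP[a ->] /vlineP[b ->] ab.
  by rewrite dist //; apply: contraNneq ab => ->.
exists u, 0; split=> //; rewrite ?memv_line ?mem0v //.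
by rewrite -[X in hamming_dist X _]scale1r -(scale0r u) dist ?oner_eq0.
Qed.

Lemma dim_upper_bound_gt0 (F : finFieldType) (m delta : nat) (K : int) :
  (0 < m)%N -> (delta <= m)%N -> dim_upper_bound F m delta K -> 0 < K.
Proof.
move=> m0 dm /(_ 1%N m _ (repetition_code F m m0) dm).
by lia.
Qed.

(** Clearing the denominator in the ceiling's defining inequalities leaves integer facts usable by
    [lia]. *)
Lemma ceil_div_bounds (k : int) (m : nat) :
  (0 < m)%N ->
  (Num.ceil (k%:Q / m%:Q) - 1) * m%:Z < k <= Num.ceil (k%:Q / m%:Q) * m%:Z.
Proof.
move=> m0; have m0' : 0 < m%:Q by rewrite ltr0n.
have /andP[h1 h2] := ceil_itv (k%:Q / m%:Q).
by rewrite -(ltr_int rat) -(ler_int rat) !intrM -ltr_pdivlMr // h1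
           -ler_pdivrMr.
Qed.

Theorem proposition2 (F : finFieldType) (n k d r delta : nat)
    (C : {vspace 'rV[F]_n}) (kB : int) :
  is_LRC k d r delta C ->
  kB <= r%:Z ->
  dim_upper_bound F (r + delta - 1) delta kB ->
  let q := #|F| in
  let t := Num.ceil (k%:Q / kB%:Q) in
  let b := k%:Z - 1 - (t - 1) * kB in
  n%:Z - t * griesmer q kB delta + griesmer q (kB - b) delta
    <= n%:Z - k%:Z + 1 - (Num.ceil (k%:Q / r%:Q) - 1) * (delta%:Z - 1).
Proof.
case=> [[k1 _ _] r0 delta0 _] kBr hB; cbv zeta.
have kB0 : 0 < kB by apply: dim_upper_bound_gt0 hB; lia.
set q := #|F|; have q0 : (0 < q)%N by apply/card_gt0P; exists 0.
case: kB kBr hB kB0 => // m mr _ m0.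
set t := Num.ceil (k%:Q / m%:Q); set b := k%:Z - 1 - (t - 1) * m%:Z.
have /andP[lo hi] : (t - 1) * m%:Z < k%:Z <= t * m%:Z.
  by apply: ceil_div_bounds; lia.
have t1 : 1 <= t by nia.
(* [lo] and [hi] say exactly that [b] is the remainder of [k - 1] modulo [m], with quotient
   [t - 1]. *)
have b0 : 0 <= b by rewrite /b; lia.
have bm : b < m%:Z by rewrite /b; lia.
have tr : Num.ceil (k%:Q / r%:Q) <= t.
  apply: le_ceil; rewrite ler_wpM2l ?ler0n // lef_pV2 ?posrE ?ltr0n //.
  by rewrite ler_int.
(* As [b < m], the number of terms [m - b] is a positive natural number. *)
have [p pE] : exists p : nat, m%:Z - b = p by exists `|m%:Z - b|%N; lia.
have hdiff : (m - p)%N%:Z <= griesmer q m delta - griesmer q p delta.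
  by apply: griesmer_diff_ge; lia.
have hG : delta%:Z + m%:Z - 1 <= griesmer q m delta.
  by apply: griesmer_ge; lia.
rewrite pE.
have h1 : (t - 1) * (delta%:Z + m%:Z - 1) <= (t - 1) * griesmer q m delta.
  by rewrite ler_wpM2l //; lia.
have h2 : (Num.ceil (k%:Q / r%:Q) - 1) * (delta%:Z - 1)
    <= (t - 1) * (delta%:Z - 1).
  by rewrite ler_wpM2r; lia.
have bE : b = m%:Z - p%:Z by lia.
(* Since [0 <= b], the truncated difference [m - p] in [hdiff] is [b] itself. *)
have hb : b <= griesmer q m delta - griesmer q p delta by lia.
(* Unfolding [b] in [hb] yields the term [- (t - 1) * m], which cancels against [h1]. The sum of the
   three bounds is then linear in the products, taken as atoms. *)
move: hb h1 h2; rewrite {1}/b.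
set G := griesmer q m delta; set G' := griesmer q p delta; move: G G' => G G'.
by move: (Num.ceil _) => s; lia.
Qed.
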